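(* Let $\mathcal{M}=(\mathbb{R}^+\times\mathbb{R},\nabla)$ be a Type $\mathcal{B}$ surface model with $\dim\{\mathfrak{K}(\mathcal{M})\}=2$, and put $\tilde\rho:=(x^1)^2\rho$. Then $E(0,\nabla)=\operatorname{Span}\{1\}$ except in the following cases, where one also requires $\tilde\rho$ to be non-zero: (1) $C_{11}{}^1=-1$, $C_{12}{}^1=0$, $C_{22}{}^1=0$, $C_{22}{}^2\neq0$; then $E(0,\nabla)=\operatorname{Span}\{1,\log(x^1)\}$ and $\tilde\rho_{11}=-(C_{12}{}^2)^2+C_{11}{}^2C_{22}{}^2$, $\tilde\rho_{12}=C_{22}{}^2$, $\tilde\rho_{21}=\tilde\rho_{22}=0$. (2) $(C_{11}{}^2,C_{12}{}^2,C_{22}{}^2)=(0,0,0)$; then $E(0,\nabla)=\operatorname{Span}\{1,x^2\}$ and $\tilde\rho_{11}=0$, $\tilde\rho_{12}=0$, $\tilde\rho_{21}=-C_{12}{}^1$, $\tilde\rho_{22}=(C_{11}{}^1-1)C_{22}{}^1-(C_{12}{}^1)^2$. (3) $(C_{11}{}^2,C_{12}{}^2,C_{22}{}^2)=-c_1(C_{11}{}^1,C_{12}{}^1,C_{22}{}^1)$ for some $c_1\in\mathbb{R}$; then $E(0,\nabla)=\operatorname{Span}\{1,x^2+c_1x^1\}$ and $\tilde\rho_{21}=c_1C_{11}{}^1C_{22}{}^1-C_{12}{}^1(1+c_1C_{12}{}^1)$, $\tilde\rho_{11}=c_1\tilde\rho_{21}$, $\tilde\rho_{22}=C_{22}{}^1(C_{11}{}^1-1)-(C_{12}{}^1)^2$,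 $\tilde\rho_{12}=c_1\tilde\rho_{22}$. (4) $C_{12}{}^1=0$, $C_{22}{}^1=0$, $C_{11}{}^1\neq-1$, $C_{22}{}^2\neq0$; then $E(0,\nabla)=\operatorname{Span}\{1,(x^1)^{C_{11}{}^1+1}\}$ and $\tilde\rho_{11}=-(C_{12}{}^2)^2+C_{11}{}^1C_{12}{}^2+C_{12}{}^2+C_{11}{}^2C_{22}{}^2$, $\tilde\rho_{12}=C_{22}{}^2$, $\tilde\rho_{21}=\tilde\rho_{22}=0$.
   Context: For a torsion free connection $\nabla$ on a surface, with $\nabla_{\partial_{x^i}}\partial_{x^j}=\Gamma_{ij}{}^k\partial_{x^k}$, put $R(X,Y)=[\nabla_X,\nabla_Y]-\nabla_{[X,Y]}$, $\rho(X,Y)=\operatorname{Tr}\{Z\mapsto R(Z,X)Y\}$, $\rho_{ij}=\rho(\partial_{x^i},\partial_{x^j})$ ($\rho$ need not be symmetric), $\tilde\rho_{ij}=(x^1)^2\rho_{ij}$. The Hessian is $\mathcal{H}f=(\partial_{x^i}\partial_{x^j}f-\Gamma_{ij}{}^k\partial_{x^k}f)\,dx^i\otimes dx^j$, and $E(0,\nabla)=\{f\in C^\infty:\mathcal{H}f=0\}$. $\mathfrak{K}(\mathcal{M})$ is the Lie algebra of affine Killing vector fields, i.e. vector fields $X$ with $\mathcal{L}_X\nabla=0$. A Type $\mathcal{B}$ surface model is $\mathbb{R}^+\times\mathbb{R}$ (coordinates $x^1>0$, $x^2$) with Christoffel symbols $\Gamma_{ij}{}^k=(x^1)^{-1}C_{ij}{}^k$,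 $C_{ij}{}^k=C_{ji}{}^k$ real constants. *)

(* Defs.v *)
From Stdlib Require Import Reals List.
From Coquelicot Require Import Coquelicot.
Import ListNotations.
Open Scope R_scope.

(** Functions and vector fields on the half-plane [x1 > 0] are represented by
    total functions on [R * R]; every property below only constrains their
    values on the open set [dom]. *)

Definition pt : Type := (R * R)%type.
Definition dom (p : pt) : Prop := 0 < fst p.

(** Tensor indices run over [i1], [i2]. *)
Inductive idx : Set := i1 | i2.

Definition sum_idx (F : idx -> R) : R := F i1 + F i2.
Definition comp (i : idx) (v : R * R) : R :=
  match i with i1 => fst v | i2 => snd v end.
Definition vec (F : idx -> R) : R * R := (F i1, F i2).

Definition slice (i : idx) (f : pt -> R) (p : pt) (t : R) : R :=
  match i with i1 => f (t, snd p) | i2 => f (fst p, t) end.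
Definition pd (i : idx) (f : pt -> R) (p : pt) : R :=
  Derive (slice i f p) (comp i p).

Fixpoint Ck (n : nat) (f : pt -> R) : Prop :=
  (forall p, dom p -> continuous f p) /\
  match n with
  | O => True
  | S m => (forall i p, dom p -> ex_derive (slice i f p) (comp i p)) /\
           (forall i, Ck m (pd i f))
  end.
Definition smooth (f : pt -> R) : Prop := forall n, Ck n f.

Definition vfield : Type := pt -> R * R.
Definition smooth_vf (X : vfield) : Prop :=
  forall i, smooth (fun p => comp i (X p)).
Definition coord_vf (i : idx) : vfield :=
  fun _ => match i with i1 => (1, 0) | i2 => (0, 1) end.
Definition vf_minus (X Y : vfield) : vfield :=
  fun p => vec (fun k => comp k (X p) - comp k (Y p)).

Definition bracket (X Y : vfield) : vfield := fun p =>
  vec (fun k => sum_idx (fun i =>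
    comp i (X p) * pd i (fun q => comp k (Y q)) p
    - comp i (Y p) * pd i (fun q => comp k (X q)) p)).

(** [G i j k] is the Christoffel symbol with lower indices [i], [j] and upper
    index [k]. *)
Definition christoffel : Type := idx -> idx -> idx -> pt -> R.

(** The connection determined by
    [nabla_{d_i} d_j = sum_k G i j k * d_k]. *)
Definition nabla (G : christoffel) (X Y : vfield) : vfield := fun p =>
  vec (fun k => sum_idx (fun i =>
    comp i (X p) * (pd i (fun q => comp k (Y q)) p
                    + sum_idx (fun j => G i j k p * comp j (Y p))))).

Definition curvature (G : christoffel) (X Y Z : vfield) : vfield :=
  vf_minus
    (vf_minus (nabla G X (nabla G Y Z)) (nabla G Y (nabla G X Z)))
    (nabla G (bracket X Y) Z).

(** Trace of [Z |-> R(Z, X) Y], in the coordinate frame. *)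
Definition ricci (G : christoffel) (X Y : vfield) (p : pt) : R :=
  sum_idx (fun k => comp k (curvature G (coord_vf k) X Y p)).

Definition rho_tilde (G : christoffel) (i j : idx) (p : pt) : R :=
  (fst p) ^ 2 * ricci G (coord_vf i) (coord_vf j) p.

Definition rho_tilde_nonzero (G : christoffel) : Prop :=
  exists i j p, dom p /\ rho_tilde G i j p <> 0.

Definition hessian (G : christoffel) (f : pt -> R) (i j : idx) (p : pt) : R :=
  pd i (pd j f) p - sum_idx (fun k => G i j k p * pd k f p).

(** The solution space [E(0, nabla)]. *)
Definition E0 (G : christoffel) (f : pt -> R) : Prop :=
  smooth f /\ forall i j p, dom p -> hessian G f i j p = 0.

(** [(L_X nabla)(Y, Z) = [X, nabla_Y Z] - nabla_[X,Y] Z - nabla_Y [X,Z]]. *)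
Definition lie_nabla (G : christoffel) (X Y Z : vfield) : vfield :=
  vf_minus
    (vf_minus (bracket X (nabla G Y Z)) (nabla G (bracket X Y) Z))
    (nabla G Y (bracket X Z)).

Definition killing (G : christoffel) (X : vfield) : Prop :=
  smooth_vf X /\
  forall Y Z, smooth_vf Y -> smooth_vf Z ->
    forall p, dom p -> lie_nabla G X Y Z p = (0, 0).

(** Real linear algebra for functions on [dom] with values in [V] ([R] for
    functions, [R * R] for vector fields). *)
Section LinearAlgebra.
Context {V : ModuleSpace R_Ring}.

Fixpoint lincomb (a : list R) (es : list (pt -> V)) (p : pt) : V :=
  match a, es with
  | c :: a', e :: es' => plus (scal c (e p)) (lincomb a' es' p)
  | _, _ => zero
  end.

Definition in_span (es : list (pt -> V)) (f : pt -> V) : Prop :=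
  exists a, length a = length es /\
    forall p, dom p -> f p = lincomb a es p.

Definition lin_indep (es : list (pt -> V)) : Prop :=
  forall a, length a = length es ->
    (forall p, dom p -> lincomb a es p = zero) -> List.Forall (fun c => c = 0) a.

Definition has_dim (W : (pt -> V) -> Prop) (n : nat) : Prop :=
  exists es, length es = n /\ List.Forall W es /\ lin_indep es /\
    forall f, W f -> in_span es f.

Definition is_span (W : (pt -> V) -> Prop) (es : list (pt -> V)) : Prop :=
  forall f, W f <-> in_span es f.

End LinearAlgebra.

Definition type_B (C : idx -> idx -> idx -> R) : christoffel :=
  fun i j k p => / fst p * C i j k.

Definition case1 (C : idx -> idx -> idx -> R) : Prop :=
  C i1 i1 i1 = -1 /\ C i1 i2 i1 = 0 /\ C i2 i2 i1 = 0 /\ C i2 i2 i2 <> 0.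

Definition case2 (C : idx -> idx -> idx -> R) : Prop :=
  C i1 i1 i2 = 0 /\ C i1 i2 i2 = 0 /\ C i2 i2 i2 = 0.

Definition case3 (C : idx -> idx -> idx -> R) (c1 : R) : Prop :=
  C i1 i1 i2 = - c1 * C i1 i1 i1 /\
  C i1 i2 i2 = - c1 * C i1 i2 i1 /\
  C i2 i2 i2 = - c1 * C i2 i2 i1.

Definition case4 (C : idx -> idx -> idx -> R) : Prop :=
  C i1 i2 i1 = 0 /\ C i2 i2 i1 = 0 /\ C i1 i1 i1 <> -1 /\ C i2 i2 i2 <> 0.

(* Main.v *)
Require Import Defs.
From Stdlib Require Import Reals List.
From Coquelicot Require Import Coquelicot.
Import ListNotations.
Open Scope R_scope.
From Stdlib Require Import Lra.
(* [comp] must denote the component of a vector, not composition. *)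
Import Defs.

(** Write [a, b, c, d, e, g] for [C i1 i1 i1], [C i1 i1 i2], [C i1 i2 i1], [C i1 i2 i2],
    [C i2 i2 i1], [C i2 i2 i2].  A function [f] has zero Hessian exactly when the
    1-form [df] is parallel, so the curvature annihilates [df].  In dimension two this
    reads [rho_2j * d1 f = rho_1j * d2 f] ([E0_ricci]).  For a type B connection
    [rho_tilde] is a constant matrix [ric C]; if it is non-zero, the gradients of all
    solutions lie on one fixed line [al * d1 f + be * d2 f = 0] ([E0_gradient_line]).

    The four exceptional spans follow: one checks that the listed function [F] is a
    solution, and if [f] is another one then [df = h dF] with [dh] vanishing, because
    both forms are parallel; hence [f = const + h F] ([span_one_fun]).

    Conversely, a solution with [df <> 0] at one point forces relations between the
    constants ([E0_nonconstant_cases]).  If [be = 0], then [b = d = g = 0].  Otherwise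
    [d2 f = lam * d1 f]; differentiating this and adding the curvature identity for
    [j = 1] leaves either [c = e = 0] or [case3] with [c1 = 1 / lam].  This is one of the
    listed cases unless [c = e = g = 0] or the connection is Ricci flat.

    The hypothesis on Killing fields excludes those two possibilities.  Translations
    [d_2] and the dilation field [x1 d_1 + x2 d_2] are always Killing, so a third
    independent Killing field contradicts dimension 2 ([dim2_no_three]).
    If [c = e = g = 0], the field [h(x1) d_2] is Killing for [h] with
    [h'' = (a - 2 d) h' / x1], that is a power or the logarithm of [x1]
    ([degenerate_not_dim2]).  If the connection is Ricci flat, the algebraic equations
    [rho_tilde = 0] give either [c = e = g = 0] again, or [case3] with parameter
    [m = c / e] and [a = 1 - d] ([flat_cases]); then [(d_1 - m d_2) / x1] is Killing
    ([killing_radial]). *)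

(** * Calculus of smooth functions on the half-plane *)

(** [dom] is open along coordinate lines, so a property valid on [dom] holds near each
    of its points inside a slice; this makes [pd] depend only on values in [dom]. *)
Lemma dom_locally_slice (P : pt -> Prop) (i : idx) (p : pt) :
  dom p -> (forall q, dom q -> P q) ->
  locally (comp i p)
    (fun t => P (match i with i1 => (t, snd p) | i2 => (fst p, t) end)).
Proof.
  intros hp hP; destruct i; simpl.
  - exists (mkposreal _ hp); intros t ht; apply hP.
    apply Rabs_def2 in ht; unfold dom; simpl in *.
    unfold minus, plus, opp in ht; simpl in ht; lra.
  - exists (mkposreal _ hp); intros t _; apply hP; exact hp.
Qed.

Lemma dom_open (p : pt) : dom p -> locally p dom.
Proof.
  intros hp; exists (mkposreal _ hp); intros q [hq _].
  apply Rabs_def2 in hq; unfold dom; simpl in *.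
  unfold minus, plus, opp in hq; simpl in hq; lra.
Qed.

Lemma slice_comp (i : idx) (f : pt -> R) (p : pt) : slice i f p (comp i p) = f p.
Proof. destruct p, i; reflexivity. Qed.

Lemma slice_ext (f g : pt -> R) (i : idx) (p : pt) :
  dom p -> (forall q, dom q -> f q = g q) ->
  locally (comp i p) (fun t => slice i f p t = slice i g p t).
Proof.
  intros hp h; pose proof (dom_locally_slice (fun q => f q = g q) i p hp h) as H.
  destruct i; exact H.
Qed.

Lemma pd_ext (f g : pt -> R) (i : idx) (p : pt) :
  (forall q, dom q -> f q = g q) -> dom p -> pd i f p = pd i g p.
Proof. intros h hp; apply Derive_ext_loc, slice_ext; assumption. Qed.

Lemma Ck_ext (n : nat) : forall f g,
  (forall q, dom q -> f q = g q) -> Ck n f -> Ck n g.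
Proof.
  induction n as [|n IH]; intros f g h [hc hd];
    (split; [intros p hp; apply continuous_ext_loc with f; [|now apply hc];
       apply (filter_imp dom); [exact h | now apply dom_open] |]).
  - exact I.
  - destruct hd as [he hd]; split.
    + intros i p hp.
      apply ex_derive_ext_loc with (slice i f p); [now apply slice_ext | now apply he].
    + intros i; apply IH with (pd i f); [|apply hd].
      intros q hq; now apply pd_ext.
Qed.

Lemma Ck_pred (n : nat) : forall f, Ck (S n) f -> Ck n f.
Proof.
  induction n as [|n IH]; intros f [hc [he hd]]; split; auto.
Qed.

Lemma smooth_ext (f g : pt -> R) :
  (forall q, dom q -> f q = g q) -> smooth f -> smooth g.
Proof. intros h hf n; apply (Ck_ext n f); auto. Qed.

Lemma smooth_continuous (f : pt -> R) (p : pt) :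
  smooth f -> dom p -> continuous f p.
Proof. intros hf; apply (hf O). Qed.

Lemma smooth_ex_derive (f : pt -> R) (i : idx) (p : pt) :
  smooth f -> dom p -> ex_derive (slice i f p) (comp i p).
Proof. intros hf; apply (hf 1%nat). Qed.

Lemma smooth_pd (i : idx) (f : pt -> R) : smooth f -> smooth (pd i f).
Proof. intros hf n; apply (hf (S n)). Qed.

Lemma Ck_const (n : nat) : forall c, Ck n (fun _ => c).
Proof.
  assert (h : forall i c p, dom p -> 0 = pd i (fun _ => c) p)
    by (intros [] c p _; symmetry; exact (Derive_const c _)).
  induction n as [|n IH]; intros c; split; try (intros; apply continuous_const).
  - exact I.
  - split.
    + intros [] p hp; apply ex_derive_const.
    + intros i; apply Ck_ext with (fun _ => 0); auto.
Qed.

Lemma smooth_const (c : R) : smooth (fun _ => c).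
Proof. intros n; apply Ck_const. Qed.

Lemma pd_const (i : idx) (c : R) (p : pt) : pd i (fun _ => c) p = 0.
Proof. destruct i; exact (Derive_const c _). Qed.

(** The product rules come first for [Ck (S n)] functions, because stability of [Ck n]
    under sums and products is proved by induction with their help. *)
Lemma Ck1_ex_derive (n : nat) (f : pt -> R) (i : idx) (p : pt) :
  Ck (S n) f -> dom p -> ex_derive (slice i f p) (comp i p).
Proof. intros [_ [he _]]; auto. Qed.

Lemma slice_fun2 (op : R -> R -> R) (i : idx) (f g : pt -> R) (p : pt) :
  slice i (fun q => op (f q) (g q)) p = fun t => op (slice i f p t) (slice i g p t).
Proof. destruct i; reflexivity. Qed.

Lemma pd_plus_Ck (n m : nat) (i : idx) (f g : pt -> R) (p : pt) :
  Ck (S n) f -> Ck (S m) g -> dom p ->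
  pd i (fun q => f q + g q) p = pd i f p + pd i g p.
Proof.
  intros hf hg hp; unfold pd; rewrite (slice_fun2 Rplus).
  apply Derive_plus; eapply Ck1_ex_derive; eassumption.
Qed.

Lemma pd_mult_Ck (n m : nat) (i : idx) (f g : pt -> R) (p : pt) :
  Ck (S n) f -> Ck (S m) g -> dom p ->
  pd i (fun q => f q * g q) p = pd i f p * g p + f p * pd i g p.
Proof.
  intros hf hg hp; unfold pd; rewrite (slice_fun2 Rmult).
  rewrite Derive_mult; [|eapply Ck1_ex_derive; eassumption ..].
  now rewrite !slice_comp.
Qed.

Lemma Ck_plus (n : nat) : forall f g, Ck n f -> Ck n g -> Ck n (fun q => f q + g q).
Proof.
  induction n as [|n IH]; intros f g hf hg.
  - split; [|exact I]; intros p hp.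
    apply (continuous_plus f g); [apply hf | apply hg]; exact hp.
  - split; [intros p hp; apply (continuous_plus f g); [apply hf | apply hg]; exact hp|].
    split.
    + intros i p hp; rewrite (slice_fun2 Rplus).
      apply (ex_derive_plus (slice i f p) (slice i g p));
        eapply Ck1_ex_derive; eassumption.
    + intros i; apply Ck_ext with (fun q => pd i f q + pd i g q).
      * intros q hq; symmetry; eapply pd_plus_Ck; eassumption.
      * apply IH; [apply hf | apply hg].
Qed.

Lemma Ck_mult (n : nat) : forall f g, Ck n f -> Ck n g -> Ck n (fun q => f q * g q).
Proof.
  induction n as [|n IH]; intros f g hf hg.
  - split; [|exact I]; intros p hp.
    apply (continuous_mult f g); [apply hf | apply hg]; exact hp.
  - split; [intros p hp; apply (continuous_mult f g); [apply hf | apply hg]; exact hp|].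
    split.
    + intros i p hp; rewrite (slice_fun2 Rmult).
      apply ex_derive_mult; eapply Ck1_ex_derive; eassumption.
    + intros i; apply Ck_ext with (fun q => pd i f q * g q + f q * pd i g q).
      * intros q hq; symmetry; eapply pd_mult_Ck; eassumption.
      * apply Ck_plus; apply IH; (apply hf || apply hg || (apply Ck_pred; assumption)).
Qed.

Lemma smooth_plus (f g : pt -> R) :
  smooth f -> smooth g -> smooth (fun q => f q + g q).
Proof. intros hf hg n; apply Ck_plus; auto. Qed.

Lemma smooth_mult (f g : pt -> R) :
  smooth f -> smooth g -> smooth (fun q => f q * g q).
Proof. intros hf hg n; apply Ck_mult; auto. Qed.

Lemma smooth_minus (f g : pt -> R) :
  smooth f -> smooth g -> smooth (fun q => f q - g q).
Proof.
  intros hf hg; apply smooth_ext with (fun q => f q + -1 * g q); [intros; ring|].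
  apply smooth_plus, smooth_mult; auto using smooth_const.
Qed.

Lemma pd_plus (i : idx) (f g : pt -> R) (p : pt) :
  smooth f -> smooth g -> dom p ->
  pd i (fun q => f q + g q) p = pd i f p + pd i g p.
Proof. intros hf hg; exact (pd_plus_Ck _ _ i f g p (hf 1%nat) (hg 1%nat)). Qed.

Lemma pd_mult (i : idx) (f g : pt -> R) (p : pt) :
  smooth f -> smooth g -> dom p ->
  pd i (fun q => f q * g q) p = pd i f p * g p + f p * pd i g p.
Proof. intros hf hg; exact (pd_mult_Ck _ _ i f g p (hf 1%nat) (hg 1%nat)). Qed.

Lemma pd_minus (i : idx) (f g : pt -> R) (p : pt) :
  smooth f -> smooth g -> dom p ->
  pd i (fun q => f q - g q) p = pd i f p - pd i g p.
Proof.
  intros hf hg hp.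
  rewrite (pd_ext _ (fun q => f q + -1 * g q)); [|intros; ring|exact hp].
  rewrite pd_plus, pd_mult, pd_const; auto using smooth_const, smooth_mult; ring.
Qed.

Lemma pd_comm (f : pt -> R) (p : pt) :
  smooth f -> dom p -> pd i1 (pd i2 f) p = pd i2 (pd i1 f) p.
Proof.
  intros hf hp; destruct p as [x y].
  apply (Schwarz (fun a b => f (a, b)) x y).
  - apply locally_2d_locally; apply (filter_imp dom); [|now apply dom_open].
    intros q hq; repeat split.
    + exact (smooth_ex_derive f i1 q hf hq).
    + exact (smooth_ex_derive f i2 q hf hq).
    + exact (smooth_ex_derive (pd i2 f) i1 q (smooth_pd i2 f hf) hq).
    + exact (smooth_ex_derive (pd i1 f) i2 q (smooth_pd i1 f hf) hq).
  - apply continuity_2d_pt_filterlim.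
    exact (smooth_continuous (pd i1 (pd i2 f)) (x, y) (smooth_pd _ _ (smooth_pd _ _ hf)) hp).
  - apply continuity_2d_pt_filterlim.
    exact (smooth_continuous (pd i2 (pd i1 f)) (x, y) (smooth_pd _ _ (smooth_pd _ _ hf)) hp).
Qed.

(** The two points come in either order, which spares the caller a case distinction. *)
Lemma derive_zero_eq (h : R -> R) (a b : R) :
  (forall t, Rmin a b <= t <= Rmax a b -> ex_derive h t /\ Derive h t = 0) -> h a = h b.
Proof.
  assert (H : forall u v, u < v ->
      (forall t, u <= t <= v -> ex_derive h t /\ Derive h t = 0) -> h u = h v).
  { intros u v huv H; apply (eq_is_derive h u v); [|exact huv].
    intros t ht; destruct (H t ht) as [e d].
    change (zero : R) with 0; rewrite <- d; now apply Derive_correct. }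
  intros hd; destruct (Rtotal_order a b) as [l|[e|l]].
  - apply H; [exact l|]; intros t ht; apply hd.
    rewrite Rmin_left, Rmax_right; lra.
  - now rewrite e.
  - symmetry; apply H; [exact l|]; intros t ht; apply hd.
    rewrite Rmin_right, Rmax_left; lra.
Qed.

(** Each point is joined to the base point [(1, 0)] by a horizontal and a vertical
    segment inside the half-plane, and [f] is constant on both. *)
Lemma pd_zero_const (f : pt -> R) :
  smooth f -> (forall i p, dom p -> pd i f p = 0) ->
  forall p, dom p -> f p = f (1, 0).
Proof.
  intros hf h [x y] hp; unfold dom in hp; simpl in hp.
  transitivity (f (1, y)).
  - apply (derive_zero_eq (fun t => f (t, y))); intros t ht.
    assert (dom (t, y)) by (unfold dom, Rmin in *; simpl; destruct Rle_dec; lra).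
    split; [exact (smooth_ex_derive f i1 (t, y) hf H) | exact (h i1 (t, y) H)].
  - apply (derive_zero_eq (fun t => f (1, t))); intros t ht.
    assert (dom (1, t)) by (unfold dom; simpl; lra).
    split; [exact (smooth_ex_derive f i2 (1, t) hf H) | exact (h i2 (1, t) H)].
Qed.

Lemma pd_eq_const (f g : pt -> R) :
  smooth f -> smooth g -> (forall i p, dom p -> pd i f p = pd i g p) ->
  exists c, forall p, dom p -> f p = c + g p.
Proof.
  intros hf hg h; exists (f (1, 0) - g (1, 0)); intros p hp.
  enough (f p - g p = f (1, 0) - g (1, 0)) by lra.
  apply (pd_zero_const (fun q => f q - g q)); auto using smooth_minus.
  intros i q hq; rewrite pd_minus; auto; rewrite h; auto; ring.
Qed.

(** * The elementary functions of the classification *)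

Definition fst_power (s : R) : pt -> R := fun p => Rpower (fst p) s.

Lemma pd1_power (s : R) (p : pt) :
  dom p -> pd i1 (fst_power s) p = s * fst_power (s - 1) p.
Proof.
  intros hp; apply is_derive_unique, is_derive_Reals.
  now apply derivable_pt_lim_power.
Qed.

Lemma pd2_fst (g : R -> R) (p : pt) : pd i2 (fun q => g (fst q)) p = 0.
Proof. exact (Derive_const (g (fst p)) _). Qed.

Lemma continuous_fst_comp (g : R -> R) (p : pt) :
  ex_derive g (fst p) -> continuous (fun q : pt => g (fst q)) p.
Proof.
  intros hg; apply (continuous_comp (fst : pt -> R) g).
  - destruct p; apply continuous_fst.
  - exact (ex_derive_continuous g (fst p) hg).
Qed.

Lemma ex_derive_power (s x : R) : 0 < x -> ex_derive (fun t => Rpower t s) x.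
Proof.
  intros hx; exists (s * Rpower x (s - 1)); apply is_derive_Reals.
  now apply derivable_pt_lim_power.
Qed.

(** The second partial derivative of a function of [fst] alone vanishes, so only the
    first one has to be followed in an induction on the order of differentiability. *)
Lemma Ck_fst_step (n : nat) (g : R -> R) (g' : pt -> R) :
  (forall x, 0 < x -> ex_derive g x) ->
  (forall p, dom p -> g' p = Derive g (fst p)) ->
  Ck n g' -> Ck (S n) (fun q => g (fst q)).
Proof.
  intros he hd hn; split; [|split].
  - intros p hp; apply continuous_fst_comp, he, hp.
  - intros [] p hp; simpl; [now apply he | exact (ex_derive_const (g (fst p)) _)].
  - intros []; [exact (Ck_ext n _ _ hd hn)|].
    apply Ck_ext with (fun _ => 0); [|apply Ck_const].
    intros q hq; symmetry; apply pd2_fst.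
Qed.

(** The exponent varies in the induction: the derivative of a power is a multiple of
    another power. *)
Lemma Ck_power (n : nat) : forall s, Ck n (fst_power s).
Proof.
  induction n as [|n IH]; intros s.
  - split; [|exact I]; intros p hp.
    apply (continuous_fst_comp (fun t => Rpower t s)), ex_derive_power, hp.
  - apply (Ck_fst_step n (fun t => Rpower t s) (fun p => s * fst_power (s - 1) p)).
    + intros x; apply ex_derive_power.
    + intros p hp; symmetry; now apply pd1_power.
    + apply Ck_mult; [apply Ck_const | apply IH].
Qed.

Lemma smooth_power (s : R) : smooth (fst_power s).
Proof. intros n; apply Ck_power. Qed.

Lemma power_m1 (p : pt) : dom p -> fst_power (-1) p = / fst p.
Proof.
  intros hp; unfold fst_power; replace (-1) with (Ropp 1) by ring.
  rewrite Rpower_Ropp, Rpower_1; [reflexivity|exact hp].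
Qed.

Lemma power_minus1 (s : R) (p : pt) : dom p -> fst_power (s - 1) p = / fst p * fst_power s p.
Proof.
  intros hp; rewrite <- power_m1 by exact hp; unfold fst_power.
  rewrite <- Rpower_plus; f_equal; ring.
Qed.

Lemma smooth_inv : smooth (fun p => / fst p).
Proof. apply smooth_ext with (fst_power (-1)); [exact power_m1 | apply smooth_power]. Qed.

Lemma pd1_inv (p : pt) : dom p -> pd i1 (fun q => / fst q) p = - (/ fst p * / fst p).
Proof.
  intros hp; rewrite (pd_ext _ (fst_power (-1))), pd1_power, power_minus1, power_m1
    by (auto; intros; symmetry; now apply power_m1).
  ring.
Qed.

Definition ln_fst : pt -> R := fun p => ln (fst p).

Lemma pd1_ln (p : pt) : dom p -> pd i1 ln_fst p = / fst p.
Proof. intros hp; apply is_derive_unique, is_derive_ln, hp. Qed.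

Lemma smooth_ln : smooth ln_fst.
Proof.
  intros n; apply Ck_pred.
  apply (Ck_fst_step n ln (fun p => / fst p)).
  - intros x hx; exists (/ x); now apply is_derive_ln.
  - intros p hp; symmetry; now apply pd1_ln.
  - apply smooth_inv.
Qed.

Lemma pd_fst (i : idx) (p : pt) :
  pd i (fun q => fst q) p = match i with i1 => 1 | i2 => 0 end.
Proof. destruct i; [exact (Derive_id _) | exact (Derive_const (fst p) _)]. Qed.

Lemma pd_snd (i : idx) (p : pt) :
  pd i (fun q => snd q) p = match i with i1 => 0 | i2 => 1 end.
Proof. destruct i; [exact (Derive_const (snd p) _) | exact (Derive_id _)]. Qed.

Lemma smooth_coord (j : idx) : smooth (fun q => comp j q).
Proof.
  intros n; apply Ck_pred; split; [|split].
  - intros [x y] _; destruct j; [apply continuous_fst | apply continuous_snd].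
  - intros i p _; destruct i, j;
      first [exact (ex_derive_id _) | exact (ex_derive_const (fst p) _)
            | exact (ex_derive_const (snd p) _)].
  - intros i; destruct i, j; (eapply Ck_ext;
      [ intros q _; symmetry;
        first [apply (pd_fst i1) | apply (pd_fst i2) | apply (pd_snd i1) | apply (pd_snd i2)]
      | apply Ck_const ]).
Qed.

Lemma smooth_fst : smooth (fun q => fst q).
Proof. exact (smooth_coord i1). Qed.

Lemma smooth_snd : smooth (fun q => snd q).
Proof. exact (smooth_coord i2). Qed.

(** * Coordinate formulas *)

Definition smooth_christoffel (G : christoffel) : Prop :=
  forall i j k, smooth (G i j k).

Create HintDb smooth.
#[local] Hint Resolve smooth_const smooth_plus smooth_minus smooth_mult smooth_pd
  smooth_fst smooth_snd smooth_inv smooth_ln smooth_power : smooth.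

Lemma pd_pd_const (i j : idx) (c : R) (p : pt) :
  dom p -> pd i (fun q => pd j (fun _ => c) q) p = 0.
Proof.
  intros hp; rewrite (pd_ext _ (fun _ => 0)), pd_const; auto using pd_const.
Qed.

(* Leibniz rule and linearity, used as a simplifier for partial derivatives. *)
Ltac pd_expand :=
  repeat first [ rewrite pd_const | rewrite pd_pd_const by assumption
    | rewrite pd_plus by auto 12 with smooth
    | rewrite pd_minus by auto 12 with smooth | rewrite pd_mult by auto 12 with smooth ].

(** In the coordinate frame brackets vanish, and the trace of the curvature becomes the
    classical expression in the Christoffel symbols. *)
Lemma ricci_coord (G : christoffel) (i j : idx) (p : pt) :
  smooth_christoffel G -> dom p ->
  ricci G (coord_vf i) (coord_vf j) p =
    sum_idx (fun k => pd k (G i j k) p - pd i (G k j k) p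
      + sum_idx (fun l => G k l k p * G i j l p - G i l k p * G k j l p)).
Proof.
  intros hG hp.
  assert (hG' : forall i j k, smooth (fun q => G i j k q)) by exact hG.
  assert (heta : forall i j k l, pd l (fun q => G i j k q) p = pd l (G i j k) p) by reflexivity.
  destruct i, j;
    cbv [ricci curvature vf_minus nabla bracket vec comp sum_idx coord_vf fst snd];
    pd_expand; rewrite ?heta; ring.
Qed.

Lemma coords_smooth (X : vfield) : smooth_vf X ->
  smooth (fun q => fst (X q)) /\ smooth (fun q => snd (X q)).
Proof. intros h; exact (conj (h i1) (h i2)). Qed.

(** The components of the tensor obtained as Lie derivative of the connection along [X]. *)
Definition lie_coord (G : christoffel) (X : vfield) (i j k : idx) (p : pt) : R :=
  pd i (pd j (fun q => comp k (X q))) p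
  + sum_idx (fun l =>
      comp l (X p) * pd l (G i j k) p
      + G l j k p * pd i (fun q => comp l (X q)) p
      + G i l k p * pd j (fun q => comp l (X q)) p
      - G i j l p * pd l (fun q => comp k (X q)) p).

(** The Lie derivative of a connection is a tensor: all derivatives of [Y] cancel, and
    those of [Z] cancel once its mixed second derivatives are identified. *)
Lemma lie_nabla_coord (G : christoffel) (X Y Z : vfield) (k : idx) (p : pt) :
  smooth_christoffel G -> smooth_vf X -> smooth_vf Y -> smooth_vf Z -> dom p ->
  comp k (lie_nabla G X Y Z p) =
    sum_idx (fun i => sum_idx (fun j =>
      comp i (Y p) * comp j (Z p) * lie_coord G X i j k p)).
Proof.
  intros hG hX hY hZ hp.
  destruct (coords_smooth X hX) as [hX1 hX2], (coords_smooth Y hY) as [hY1 hY2],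
    (coords_smooth Z hZ) as [hZ1 hZ2].
  assert (hG' : forall i j k, smooth (fun q => G i j k q)) by exact hG.
  assert (heta : forall i j k l, pd l (fun q => G i j k q) p = pd l (G i j k) p) by reflexivity.
  assert (hp1 : forall f i, smooth f -> smooth (fun q => pd i f q))
    by (intros f i; apply smooth_pd).
  assert (heta2 : forall i j f, pd i (fun q => pd j f q) p = pd i (pd j f) p) by reflexivity.
  unfold lie_coord.
  destruct k;
    cbv [lie_nabla vf_minus nabla bracket vec comp sum_idx];
    cbn [fst snd].
  all: pd_expand; rewrite ?heta, ?heta2.
  (* The component [k] decides which coordinate of [X] and [Z] is differentiated twice. *)
  all: rewrite !(pd_comm (fun q => fst (Z q)) p hZ1 hp),
               !(pd_comm (fun q => fst (X q)) p hX1 hp)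
    || rewrite !(pd_comm (fun q => snd (Z q)) p hZ2 hp),
               !(pd_comm (fun q => snd (X q)) p hX2 hp).
  all: ring.
Qed.

Lemma killing_coord (G : christoffel) (X : vfield) :
  smooth_christoffel G -> smooth_vf X ->
  (forall i j k p, dom p -> lie_coord G X i j k p = 0) -> killing G X.
Proof.
  intros hG hX h; split; [exact hX|]; intros Y Z hY hZ p hp.
  assert (hk : forall k, comp k (lie_nabla G X Y Z p) = 0).
  { intros k; rewrite lie_nabla_coord by assumption; unfold sum_idx.
    rewrite !h by assumption; ring. }
  apply injective_projections; [exact (hk i1) | exact (hk i2)].
Qed.

(** * Functions with vanishing Hessian *)

Lemma E0_pd_pd (G : christoffel) (f : pt -> R) (i j : idx) (p : pt) :
  E0 G f -> dom p ->
  pd i (pd j f) p = sum_idx (fun k => G i j k p * pd k f p).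
Proof.
  intros [_ h] hp; specialize (h i j p hp); unfold hessian in h; lra.
Qed.

(** Commuting the first two derivatives in [pd i (pd l (pd j f))] and replacing second
    derivatives by first ones shows that the curvature annihilates the differential;
    in dimension two the operator [R(d_1, d_2)] is read off from the Ricci tensor. *)
Lemma E0_ricci (G : christoffel) (f : pt -> R) (j : idx) (p : pt) :
  smooth_christoffel G -> E0 G f -> dom p ->
  ricci G (coord_vf i2) (coord_vf j) p * pd i1 f p
  = ricci G (coord_vf i1) (coord_vf j) p * pd i2 f p.
Proof.
  intros hG hf hp; pose proof (proj1 hf) as sf.
  assert (hG' : forall i j k, smooth (fun q => G i j k q)) by exact hG.
  assert (hp1 : forall i, smooth (fun q => pd i f q)) by (intros i; now apply smooth_pd).
  assert (H : forall i l, pd i (pd l (pd j f)) p =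
    sum_idx (fun k => pd i (G l j k) p * pd k f p
      + G l j k p * sum_idx (fun m => G i k m p * pd m f p))).
  { intros i l; rewrite (pd_ext _ _ i p (fun q hq => E0_pd_pd G f l j q hf hq) hp).
    unfold sum_idx; pd_expand.
    change (pd i (fun q => pd i1 f q) p) with (pd i (pd i1 f) p).
    change (pd i (fun q => pd i2 f q) p) with (pd i (pd i2 f) p).
    rewrite !(E0_pd_pd G f i _ p hf hp); unfold sum_idx.
    change (pd i (fun q => G l j i1 q) p) with (pd i (G l j i1) p).
    change (pd i (fun q => G l j i2 q) p) with (pd i (G l j i2) p).
    ring. }
  pose proof (pd_comm (pd j f) p (smooth_pd j f sf) hp) as S.
  rewrite !H in S; rewrite !ricci_coord by assumption.
  unfold sum_idx in *; lra.
Qed.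

Lemma E0_ext (G : christoffel) (f g : pt -> R) :
  (forall p, dom p -> f p = g p) -> E0 G f -> E0 G g.
Proof.
  intros h [sf hf]; split; [now apply smooth_ext with f|].
  intros i j p hp; rewrite <- (hf i j p hp); unfold hessian, sum_idx.
  rewrite !(fun i => pd_ext g f i p (fun q hq => eq_sym (h q hq)) hp).
  f_equal; apply pd_ext; [|exact hp].
  intros q hq; apply pd_ext; [|exact hq]; intros; symmetry; auto.
Qed.

Lemma E0_affine (G : christoffel) (g : pt -> R) (c k : R) :
  E0 G g -> E0 G (fun p => c + k * g p).
Proof.
  intros [sg hg]; split; [auto with smooth|]; intros i j p hp.
  assert (H : forall l q, dom q -> pd l (fun p => c + k * g p) q = k * pd l g q).
  { intros l q hq; pd_expand; rewrite ?pd_const; ring. }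
  unfold hessian, sum_idx; rewrite !H by exact hp.
  rewrite (pd_ext _ _ i p (H j) hp).
  pose proof (smooth_pd j g sg) as hs; pd_expand.
  change (pd i (fun q => pd j g q) p) with (pd i (pd j g) p).
  specialize (hg i j p hp); unfold hessian, sum_idx in hg.
  apply (f_equal (Rmult k)) in hg; lra.
Qed.

Lemma in_span_one (f : pt -> R) :
  in_span [fun _ : pt => 1] f <-> exists c, forall p, dom p -> f p = c.
Proof.
  split.
  - intros ([|c [|]] & hl & h); try discriminate hl; exists c; intros p hp.
    rewrite (h p hp); simpl; unfold plus, scal, zero; simpl; unfold mult; simpl; ring.
  - intros [c h]; exists [c]; split; [reflexivity|]; intros p hp.
    rewrite (h p hp); simpl; unfold plus, scal, zero; simpl; unfold mult; simpl; ring.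
Qed.

Lemma in_span_one_fun (g f : pt -> R) :
  in_span [fun _ : pt => 1; g] f <->
  exists c k, forall p, dom p -> f p = c + k * g p.
Proof.
  split.
  - intros ([|c [|k [|]]] & hl & h); try discriminate hl; exists c, k; intros p hp.
    rewrite (h p hp); simpl; unfold plus, scal, zero; simpl; unfold mult; simpl; ring.
  - intros (c & k & h); exists [c; k]; split; [reflexivity|]; intros p hp.
    rewrite (h p hp); simpl; unfold plus, scal, zero; simpl; unfold mult; simpl; ring.
Qed.

Lemma E0_const (G : christoffel) (c : R) : E0 G (fun _ => c).
Proof.
  split; [apply smooth_const|]; intros i j p hp; unfold hessian, sum_idx.
  rewrite !pd_const, (pd_pd_const i j c p hp : pd i (pd j (fun _ => c)) p = 0); ring.
Qed.

Lemma span_one (G : christoffel) :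
  (forall f i p, E0 G f -> dom p -> pd i f p = 0) ->
  is_span (E0 G) [fun _ : pt => 1].
Proof.
  intros h f; rewrite in_span_one; split.
  - intros hf; exists (f (1, 0)); apply pd_zero_const; [apply hf|]; auto.
  - intros [c hc]; apply E0_ext with (fun _ => c); [|apply E0_const].
    intros p hp; symmetry; auto.
Qed.

(** Two proportional parallel 1-forms have a constant ratio.  The ratio is written as
    [w * pd i f] with [w] a smooth inverse of [pd i g], and its derivative vanishes
    because [pd i f] and [pd i g] satisfy the same first order system. *)
Lemma span_one_fun (G : christoffel) (g w : pt -> R) (i : idx) :
  (forall f p, E0 G f -> dom p -> pd i1 f p * pd i2 g p = pd i2 f p * pd i1 g p) ->
  E0 G g -> smooth w -> (forall p, dom p -> w p * pd i g p = 1) ->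
  is_span (E0 G) [fun _ : pt => 1; g].
Proof.
  intros hprop hg hw hwg f; rewrite in_span_one_fun; split.
  - intros hf.
    pose proof (proj1 hf) as sf; pose proof (proj1 hg) as sg.
    assert (hk : forall k p, dom p -> pd k f p = w p * pd i f p * pd k g p).
    { intros k p hp; specialize (hwg p hp); specialize (hprop f p hf hp).
      transitivity (pd k f p * (w p * pd i g p)); [rewrite hwg; ring|].
      destruct i, k; try ring; rewrite <- (Rmult_1_r (_ * _ * _));
        [ transitivity (w p * (pd i2 f p * pd i1 g p)); [ring|rewrite <- hprop; ring]
        | transitivity (w p * (pd i1 f p * pd i2 g p)); [ring|rewrite hprop; ring] ]. }
    assert (sfi : smooth (fun q => pd i f q)) by now apply smooth_pd.
    assert (sgi : smooth (fun q => pd i g q)) by now apply smooth_pd.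
    set (h := fun q => w q * pd i f q).
    assert (hc : forall p, dom p -> h p = h (1, 0)).
    { apply pd_zero_const; [unfold h; auto with smooth|].
      intros j p hp; unfold h; rewrite pd_mult by auto with smooth.
      assert (H1 : pd j (fun q => w q * pd i g q) p = 0).
      { rewrite (pd_ext _ (fun _ => 1)); auto using pd_const. }
      rewrite pd_mult in H1 by auto with smooth.
      change (pd j (fun q => pd i f q) p) with (pd j (pd i f) p).
      change (pd j (fun q => pd i g q) p) with (pd j (pd i g) p) in H1.
      rewrite (E0_pd_pd G g j i p hg hp) in H1.
      rewrite (E0_pd_pd G f j i p hf hp).
      unfold sum_idx in *; rewrite (hk i1 p hp), (hk i2 p hp), (hk i p hp) at 1.
      transitivity (w p * pd i f p * 0); [rewrite <- H1; ring | ring]. }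
    destruct (pd_eq_const f (fun q => h (1, 0) * g q)) as [c h0];
      [auto with smooth | auto with smooth | | now exists c, (h (1, 0))].
    intros k p hp; rewrite pd_mult, pd_const by auto with smooth.
    rewrite (hk k p hp), <- (hc p hp); unfold h; ring.
  - intros (c & k & h); apply E0_ext with (fun p => c + k * g p).
    + intros p hp; symmetry; auto.
    + now apply E0_affine.
Qed.

(** * Type B connections *)

Lemma smooth_type_B (C : idx -> idx -> idx -> R) : smooth_christoffel (type_B C).
Proof. intros i j k; apply smooth_mult; auto with smooth. Qed.

Lemma pd_type_B (C : idx -> idx -> idx -> R) (l i j k : idx) (p : pt) :
  dom p -> pd l (type_B C i j k) p =
  match l with i1 => - (/ fst p * / fst p * C i j k) | i2 => 0 end.
Proof.
  intros hp; unfold type_B; pd_expand.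
  destruct l; [rewrite pd1_inv by exact hp | rewrite (pd2_fst Rinv)]; ring.
Qed.

(** The matrix [rho_tilde] of a type B connection, which does not depend on the point. *)
Definition ric (C : idx -> idx -> idx -> R) (i j : idx) : R :=
  match i with i1 => C i2 j i2 | i2 => 0 end - C i j i1
  + match i with i1 => C i1 j i1 | i2 => 0 end
  + sum_idx (fun k => sum_idx (fun l => C k l k * C i j l - C i l k * C k j l)).

Lemma ricci_type_B (C : idx -> idx -> idx -> R) (i j : idx) (p : pt) :
  dom p -> ricci (type_B C) (coord_vf i) (coord_vf j) p = / fst p * / fst p * ric C i j.
Proof.
  intros hp; rewrite ricci_coord by (apply smooth_type_B || exact hp).
  unfold sum_idx; rewrite !pd_type_B by exact hp.
  unfold type_B, ric, sum_idx; destruct i; ring.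
Qed.

Lemma rho_tilde_type_B (C : idx -> idx -> idx -> R) (i j : idx) (p : pt) :
  dom p -> rho_tilde (type_B C) i j p = ric C i j.
Proof.
  intros hp; unfold rho_tilde; rewrite ricci_type_B by exact hp.
  unfold dom in hp; field; lra.
Qed.

Lemma rho_nonzero_ric (C : idx -> idx -> idx -> R) :
  rho_tilde_nonzero (type_B C) <-> exists i j, ric C i j <> 0.
Proof.
  split.
  - intros (i & j & p & hp & h); exists i, j; now rewrite <- (rho_tilde_type_B C i j p hp).
  - intros (i & j & h); exists i, j, (1, 0).
    assert (hp : dom (1, 0)) by (unfold dom; simpl; lra).
    now rewrite rho_tilde_type_B.
Qed.

Lemma ric_zero (C : idx -> idx -> idx -> R) :
  ~ rho_tilde_nonzero (type_B C) -> forall i j, ric C i j = 0.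
Proof.
  intros h i j; destruct (Req_dec (ric C i j) 0) as [e|e]; [exact e|].
  exfalso; apply h, rho_nonzero_ric; eauto.
Qed.

Lemma E0_ric (C : idx -> idx -> idx -> R) (f : pt -> R) (j : idx) (p : pt) :
  E0 (type_B C) f -> dom p ->
  ric C i2 j * pd i1 f p = ric C i1 j * pd i2 f p.
Proof.
  intros hf hp; pose proof (E0_ricci _ f j p (smooth_type_B C) hf hp) as H.
  rewrite !ricci_type_B in H by exact hp; unfold dom in hp.
  apply (f_equal (fun t => fst p * fst p * t)) in H.
  transitivity (fst p * fst p * (/ fst p * / fst p * ric C i2 j * pd i1 f p));
    [field; lra | rewrite H; field; lra].
Qed.

(** One non-zero entry of [ric C] gives one non-trivial linear relation with constant
    coefficients, common to all gradients of solutions. *)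
Lemma E0_gradient_line (C : idx -> idx -> idx -> R) :
  (exists i j, ric C i j <> 0) ->
  exists al be, (al <> 0 \/ be <> 0) /\
    forall f p, E0 (type_B C) f -> dom p -> al * pd i1 f p + be * pd i2 f p = 0.
Proof.
  intros (i & j & h); exists (ric C i2 j), (- ric C i1 j); split.
  - destruct i; [right; lra | left; exact h].
  - intros f p hf hp; rewrite (E0_ric C f j p hf hp); ring.
Qed.

Lemma line_proportional (al be u v u' v' : R) :
  al <> 0 \/ be <> 0 -> al * u + be * v = 0 -> al * u' + be * v' = 0 ->
  u * v' = v * u'.
Proof.
  intros h h1 h2.
  assert (H1 : al * (u * v' - v * u') = 0).
  { replace (al * (u * v' - v * u')) with ((al * u + be * v) * v'
      - v * (al * u' + be * v')) by ring.
    rewrite h1, h2; ring. }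
  assert (H2 : be * (u * v' - v * u') = 0).
  { replace (be * (u * v' - v * u')) with (u * (al * u' + be * v')
      - (al * u + be * v) * u') by ring.
    rewrite h1, h2; ring. }
  destruct (Rmult_integral _ _ H1), (Rmult_integral _ _ H2); destruct h; lra.
Qed.

Lemma E0_gradients_proportional (C : idx -> idx -> idx -> R) (f g : pt -> R) (p : pt) :
  rho_tilde_nonzero (type_B C) -> E0 (type_B C) f -> E0 (type_B C) g -> dom p ->
  pd i1 f p * pd i2 g p = pd i2 f p * pd i1 g p.
Proof.
  intros hr hf hg hp.
  destruct (E0_gradient_line C (proj1 (rho_nonzero_ric C) hr)) as (al & be & hne & h).
  now apply (line_proportional al be); [|apply h ..].
Qed.

Lemma E0_type_B (C : idx -> idx -> idx -> R) (f : pt -> R) (i j : idx) (p : pt) :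
  E0 (type_B C) f -> dom p ->
  fst p * pd i (pd j f) p = C i j i1 * pd i1 f p + C i j i2 * pd i2 f p.
Proof.
  intros hf hp; rewrite (E0_pd_pd _ f i j p hf hp); unfold sum_idx, type_B.
  unfold dom in hp; field; lra.
Qed.

(** All conditions are extracted at the single point [p] where the gradient is not zero.
    The relation [al * d1 f + be * d2 f = 0] holds on all of [dom], so it may be
    differentiated; together with [E0_ric] this gives homogeneous linear equations for
    the gradient at [p], whose coefficients must then vanish. *)
Lemma E0_nonconstant_cases (C : idx -> idx -> idx -> R) (f : pt -> R) (i : idx) (p : pt) :
  (forall i j k, C i j k = C j i k) ->
  rho_tilde_nonzero (type_B C) -> E0 (type_B C) f -> dom p -> pd i f p <> 0 ->
  (exists c1, case3 C c1) \/ (C i1 i2 i1 = 0 /\ C i2 i2 i1 = 0).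
Proof.
  intros hC hr hf hp hne.
  destruct (E0_gradient_line C (proj1 (rho_nonzero_ric C) hr)) as (al & be & hab & hl).
  assert (hl' : forall q, dom q -> al * pd i1 f q + be * pd i2 f q = 0) by auto.
  pose proof (proj1 hf) as sf.
  assert (sfi : forall i, smooth (fun q => pd i f q)) by (intros k; now apply smooth_pd).
  pose proof (fun i j => E0_type_B C f i j p hf hp) as H.
  assert (hd : forall k, al * pd k (pd i1 f) p + be * pd k (pd i2 f) p = 0).
  { intros k; transitivity (pd k (fun q => al * pd i1 f q + be * pd i2 f q) p).
    - pd_expand; change (pd k (fun q => pd i1 f q) p) with (pd k (pd i1 f) p).
      change (pd k (fun q => pd i2 f q) p) with (pd k (pd i2 f) p); ring.
    - rewrite (pd_ext _ (fun _ => 0)), pd_const; auto. }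
  assert (Hk : forall k, (al * C k i1 i1 + be * C k i2 i1) * pd i1 f p
                       + (al * C k i1 i2 + be * C k i2 i2) * pd i2 f p = 0).
  { intros k; transitivity (al * (fst p * pd k (pd i1 f) p) + be * (fst p * pd k (pd i2 f) p)).
    - rewrite (H k i1), (H k i2); ring.
    - specialize (hd k); apply (f_equal (Rmult (fst p))) in hd; lra. }
  pose proof (E0_ric C f i1 p hf hp) as R1; pose proof (E0_ric C f i2 p hf hp) as R2.
  unfold ric, sum_idx in R1, R2.
  pose proof (Hk i1) as K1; pose proof (Hk i2) as K2; specialize (hl' p hp).
  rewrite (hC i2 i1 i1), (hC i2 i1 i2) in *.
  set (u := pd i1 f p) in *; set (v := pd i2 f p) in *.
  set (a := C i1 i1 i1) in *; set (b := C i1 i1 i2) in *; set (c := C i1 i2 i1) in *;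
  set (d := C i1 i2 i2) in *; set (e := C i2 i2 i1) in *; set (g := C i2 i2 i2) in *.
  destruct (Req_dec be 0) as [hbe|hbe].
  - (* Here [d1 f = 0], and [x2] itself is a solution. *)
    left; exists 0; unfold case3; fold a b c d e g.
    assert (hal : al <> 0) by (destruct hab; [assumption | contradiction]).
    subst be.
    assert (hu : u = 0) by (apply Rmult_eq_reg_l with al; [lra | exact hal]).
    assert (hv : v <> 0) by (destruct i; [contradiction | exact hne]).
    rewrite hu in *.
    assert (hz : forall t, t * v = 0 -> t = 0)
      by (intros t ht; destruct (Rmult_integral _ _ ht); [assumption | contradiction]).
    assert (hb : b = 0) by (apply hz, Rmult_eq_reg_l with al; [lra | exact hal]).
    assert (hdz : d = 0) by (apply hz, Rmult_eq_reg_l with al; [lra | exact hal]).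
    rewrite hb, hdz in *.
    assert (hg : g = 0) by (apply hz; lra).
    lra.
  - (* The gradient is [u * (1, lam)], so solutions are functions of [x1 + lam * x2]. *)
    set (lam := - al / be).
    assert (hv : v = lam * u) by (unfold lam; field_simplify_eq; [lra | exact hbe]).
    assert (hal : al = - lam * be) by (unfold lam; now field).
    assert (hu : u <> 0).
    { intros hu; apply hne; destruct i; [exact hu | fold v; rewrite hv, hu; ring]. }
    clearbody lam; rewrite hv in *.
    assert (hz : forall t, t * u = 0 -> t = 0)
      by (intros t ht; destruct (Rmult_integral _ _ ht); [assumption | contradiction]).
    assert (E1 : c + lam * d = lam * (a + lam * b)).
    { apply Rminus_diag_uniq, hz, Rmult_eq_reg_l with be; [|exact hbe].
      rewrite Rmult_0_r, <- K1, hal; ring. }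
    assert (E2 : e + lam * g = lam * (c + lam * d)).
    { apply Rminus_diag_uniq, hz, Rmult_eq_reg_l with be; [|exact hbe].
      rewrite Rmult_0_r, <- K2, hal; ring. }
    (* Modulo E1 and E2, the curvature identity R1 is minus [(c + lam * d) * u = 0]. *)
    assert (E3 : c + lam * d = 0).
    { apply hz; replace c with (lam * (a + lam * b) - lam * d) in * by lra.
      replace e with (lam * (lam * (a + lam * b)) - lam * g) in * by lra.
      lra. }
    rewrite E3 in E1, E2; rewrite Rmult_0_r in E2.
    destruct (Req_dec lam 0) as [hlam|hlam].
    + right; rewrite hlam in *; lra.
    + left; exists (/ lam); unfold case3; fold a b c d e g.
      assert (E4 : a + lam * b = 0) by (apply Rmult_eq_reg_l with lam; [lra | exact hlam]).
      replace a with (- lam * b) by lra; replace c with (- lam * d) by lra.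
      replace e with (- lam * g) by lra; repeat split; now field.
Qed.

(** * Dimension *)

Lemma lincomb_in_span2 {V : ModuleSpace R_Ring} (e1 e2 : pt -> V) (f : pt -> V) :
  in_span [e1; e2] f ->
  exists a b, forall p, dom p -> f p = plus (scal a (e1 p)) (scal b (e2 p)).
Proof.
  intros ([|a [|b [|]]] & hl & h); try discriminate hl; exists a, b; intros p hp.
  rewrite (h p hp); simpl; now rewrite plus_zero_r.
Qed.

(** A relation between the coordinate vectors is a relation between the vectors. *)
Lemma lincomb3_span2 {V : ModuleSpace R_Ring} (a1 a2 a3 b1 b2 b3 t1 t2 t3 : R) (x y : V) :
  t1 * a1 + t2 * a2 + t3 * a3 = 0 -> t1 * b1 + t2 * b2 + t3 * b3 = 0 ->
  plus (scal t1 (plus (scal a1 x) (scal b1 y)))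
    (plus (scal t2 (plus (scal a2 x) (scal b2 y)))
      (plus (scal t3 (plus (scal a3 x) (scal b3 y))) zero)) = zero.
Proof.
  intros ha hb.
  transitivity (plus (scal (t1 * a1 + t2 * a2 + t3 * a3) x)
                     (scal (t1 * b1 + t2 * b2 + t3 * b3) y)).
  - change (t1 * a1 + t2 * a2 + t3 * a3)
      with (plus (plus (mult t1 a1) (mult t2 a2)) (mult t3 a3)).
    change (t1 * b1 + t2 * b2 + t3 * b3)
      with (plus (plus (mult t1 b1) (mult t2 b2)) (mult t3 b3)).
    rewrite !scal_distr_l, !scal_distr_r, !scal_assoc, plus_zero_r.
    set (A1 := scal (mult t1 a1) x); set (A2 := scal (mult t2 a2) x);
      set (A3 := scal (mult t3 a3) x); set (B1 := scal (mult t1 b1) y);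
      set (B2 := scal (mult t2 b2) y); set (B3 := scal (mult t3 b3) y).
    rewrite <- !plus_assoc; f_equal.
    rewrite (plus_comm B1), <- !plus_assoc; f_equal.
    rewrite (plus_comm B2), <- !plus_assoc; f_equal.
    rewrite (plus_comm B3), <- plus_assoc; reflexivity.
  - rewrite ha, hb; change 0 with (zero : R_Ring).
    now rewrite !scal_zero_l, plus_zero_l.
Qed.

(** Write the three vectors in coordinates [a], [b].  The cross product of [a] and [b]
    is orthogonal to both, hence a relation, hence zero; then its third entry makes
    [(b2, - b1, 0)] and [(a2, - a1, 0)] relations too, and so the first vector is zero. *)
Lemma dim2_no_three {V : ModuleSpace R_Ring} (W : (pt -> V) -> Prop) (f1 f2 f3 : pt -> V) :
  has_dim W 2 -> W f1 -> W f2 -> W f3 -> ~ lin_indep [f1; f2; f3].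
Proof.
  intros ([|x [|y [|]]] & hl & _ & _ & hs) h1 h2 h3 hi; try discriminate hl.
  destruct (lincomb_in_span2 x y f1 (hs f1 h1)) as (a1 & b1 & H1).
  destruct (lincomb_in_span2 x y f2 (hs f2 h2)) as (a2 & b2 & H2).
  destruct (lincomb_in_span2 x y f3 (hs f3 h3)) as (a3 & b3 & H3).
  assert (K : forall t1 t2 t3, t1 * a1 + t2 * a2 + t3 * a3 = 0 ->
     t1 * b1 + t2 * b2 + t3 * b3 = 0 -> t1 = 0 /\ t2 = 0 /\ t3 = 0).
  { intros t1 t2 t3 ha hb.
    assert (L : List.Forall (fun c => c = 0) [t1; t2; t3]).
    { apply hi; [reflexivity|]; intros p hp; simpl.
      rewrite (H1 p hp), (H2 p hp), (H3 p hp); now apply lincomb3_span2. }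
    inversion L as [|? ? l1 L1]; inversion L1 as [|? ? l2 L2]; inversion L2; auto. }
  destruct (K (a2 * b3 - a3 * b2) (a3 * b1 - a1 * b3) (a1 * b2 - a2 * b1)) as (_ & _ & k);
    [ring | ring |].
  destruct (K b2 (- b1) 0) as (kb2 & kb1 & _); [lra | lra |].
  destruct (K a2 (- a1) 0) as (ka2 & ka1 & _); [lra | lra |].
  destruct (K 1 0 0) as (k1 & _); [nra | nra |]; lra.
Qed.

(** * Killing fields *)

Definition euler : vfield := fun p => (fst p, snd p).

Ltac killing_simpl :=
  unfold lie_coord, sum_idx; cbn [comp fst snd];
  rewrite ?pd_type_B by assumption; unfold type_B.

Lemma smooth_vf_pair (f g : pt -> R) :
  smooth f -> smooth g -> smooth_vf (fun p => (f p, g p)).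
Proof. intros hf hg []; [exact hf | exact hg]. Qed.

Lemma killing_d2 (C : idx -> idx -> idx -> R) : killing (type_B C) (coord_vf i2).
Proof.
  apply killing_coord; [apply smooth_type_B | |].
  - apply (smooth_vf_pair (fun _ => 0) (fun _ => 1)); apply smooth_const.
  - intros i j k p hp; unfold coord_vf; destruct k; killing_simpl;
      rewrite (pd_pd_const i j _ p hp : pd i (pd j (fun _ => _)) p = 0), !pd_const; ring.
Qed.

Lemma pd_pd_coord (i j : idx) (k : idx) (p : pt) :
  dom p -> pd i (pd j (fun q => comp k q)) p = 0.
Proof.
  intros hp; rewrite (pd_ext _ (fun _ => match j, k with i1, i1 | i2, i2 => 1 | _, _ => 0 end)).
  - apply pd_const.
  - intros q _; destruct j, k;
      first [apply (pd_fst i1) | apply (pd_fst i2) | apply (pd_snd i1) | apply (pd_snd i2)].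
  - exact hp.
Qed.

Lemma killing_euler (C : idx -> idx -> idx -> R) : killing (type_B C) euler.
Proof.
  apply killing_coord; [apply smooth_type_B | |].
  - apply smooth_vf_pair; [apply smooth_fst | apply smooth_snd].
  - intros i j k p hp; unfold euler, dom in *.
    destruct k; killing_simpl;
      [rewrite (pd_pd_coord i j i1 p hp : pd i (pd j (fun q => fst q)) p = 0)
      |rewrite (pd_pd_coord i j i2 p hp : pd i (pd j (fun q => snd q)) p = 0)];
      rewrite !pd_fst, !pd_snd; destruct i, j; field; lra.
Qed.

(** Under these vanishing conditions the connection is unchanged by [x2 -> x2 + h(x1)]
    to first order as soon as the single remaining component, with lower indices 1 and 1
    and upper index 2, of the Lie derivative vanishes. *)
Lemma killing_shear (C : idx -> idx -> idx -> R) (h : pt -> R) :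
  (forall i j k, C i j k = C j i k) ->
  C i1 i2 i1 = 0 -> C i2 i2 i1 = 0 -> C i2 i2 i2 = 0 ->
  smooth h -> (forall p, dom p -> pd i2 h p = 0) ->
  (forall p, dom p ->
     pd i1 (pd i1 h) p = / fst p * (C i1 i1 i1 - 2 * C i1 i2 i2) * pd i1 h p) ->
  killing (type_B C) (fun p => (0, h p)).
Proof.
  intros hC c0 e0 f0 sh h2 h11; apply killing_coord; [apply smooth_type_B | |].
  - apply smooth_vf_pair; [apply smooth_const | exact sh].
  - assert (z2 : forall i p, dom p -> pd i (pd i2 h) p = 0).
    { intros i p hp; rewrite (pd_ext _ (fun _ => 0)), pd_const; auto. }
    intros i j l p hp.
    destruct l; killing_simpl.
    + rewrite (pd_pd_const i j _ p hp : pd i (pd j (fun _ => _)) p = 0), !pd_const.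
      change (pd i (fun q => h q) p) with (pd i h p).
      change (pd j (fun q => h q) p) with (pd j h p).
      destruct i, j; rewrite ?(hC i2 i1), ?h2, ?c0, ?e0 by exact hp; ring.
    + change (pd i (pd j (fun q => h q)) p) with (pd i (pd j h) p).
      change (pd i (fun q => h q) p) with (pd i h p).
      change (pd j (fun q => h q) p) with (pd j h p).
      change (pd i1 (fun q => h q) p) with (pd i1 h p).
      change (pd i2 (fun q => h q) p) with (pd i2 h p).
      rewrite !pd_const.
      destruct i, j; rewrite ?h11, ?z2 by exact hp;
        rewrite ?(pd_comm h p sh hp : pd i1 (pd i2 h) p = pd i2 (pd i1 h) p);
        rewrite <- ?(pd_comm h p sh hp);
        rewrite ?z2, ?(hC i2 i1), ?h2, ?c0, ?e0, ?f0 by exact hp; ring.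
Qed.

(** Spells out a vanishing combination of the three fields in components. *)
Lemma lin_indep_third (X : vfield) :
  (forall a1 a2 a3, (forall p, dom p ->
      a2 * fst p + a3 * fst (X p) = 0 /\ a1 + a2 * snd p + a3 * snd (X p) = 0) ->
    a1 = 0 /\ a2 = 0 /\ a3 = 0) ->
  lin_indep [coord_vf i2; euler; X].
Proof.
  intros h [|a1 [|a2 [|a3 [|]]]] hl H; try discriminate hl.
  destruct (h a1 a2 a3) as (z1 & z2 & z3).
  - intros p hp; specialize (H p hp).
    pose proof (f_equal fst H) as H1; pose proof (f_equal snd H) as H2.
    simpl in H1, H2; unfold plus, scal, zero in H1, H2; simpl in H1, H2.
    unfold mult, plus in H1, H2; simpl in H1, H2; lra.
  - repeat constructor; assumption.
Qed.

Lemma rpower2_neq1 (s : R) : s <> 0 -> Rpower 2 s <> 1.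
Proof.
  intros hs h; unfold Rpower in h; rewrite <- exp_0 in h; apply exp_inv in h.
  assert (hl : 0 < ln 2) by (rewrite <- ln_1; apply ln_increasing; lra).
  destruct (Rmult_integral _ _ h); lra.
Qed.

Lemma lin_indep_shear (h : pt -> R) :
  h (1, 0) <> h (2, 0) -> lin_indep [coord_vf i2; euler; fun p => (0, h p)].
Proof.
  intros hne; apply lin_indep_third; intros a1 a2 a3 H.
  assert (d1 : dom (1, 0)) by (unfold dom; simpl; lra).
  assert (d2 : dom (2, 0)) by (unfold dom; simpl; lra).
  destruct (H _ d1) as [H1 H2], (H _ d2) as [H3 H4]; simpl in *.
  assert (z : a3 * (h (1, 0) - h (2, 0)) = 0) by lra.
  assert (z3 : a3 = 0) by (destruct (Rmult_integral _ _ z); lra).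
  subst a3; lra.
Qed.

(** The equation [h'' = (a - 2 d) h' / x1] is solved by [x1 ^ s], [s = a - 2 d + 1], and
    by the logarithm when that exponent is zero. *)
Lemma degenerate_not_dim2 (C : idx -> idx -> idx -> R) :
  (forall i j k, C i j k = C j i k) ->
  C i1 i2 i1 = 0 -> C i2 i2 i1 = 0 -> C i2 i2 i2 = 0 ->
  ~ has_dim (killing (type_B C)) 2.
Proof.
  intros hC c0 e0 f0 hdim.
  destruct (Req_dec (C i1 i1 i1 - 2 * C i1 i2 i2 + 1) 0) as [hs|hs].
  - apply (dim2_no_three _ (coord_vf i2) euler (fun p => (0, ln_fst p)) hdim);
      auto using killing_d2, killing_euler.
    + apply killing_shear; auto using smooth_ln.
      * intros p _; apply (pd2_fst ln).
      * intros p hp; rewrite (pd_ext _ _ i1 p pd1_ln hp), pd1_ln, pd1_inv by exact hp.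
        replace (C i1 i1 i1 - 2 * C i1 i2 i2) with (-1) by lra; ring.
    + apply lin_indep_shear; unfold ln_fst; simpl.
      apply Rlt_not_eq, ln_increasing; lra.
  - set (s := C i1 i1 i1 - 2 * C i1 i2 i2 + 1) in *.
    apply (dim2_no_three _ (coord_vf i2) euler (fun p => (0, fst_power s p)) hdim);
      auto using killing_d2, killing_euler.
    + apply killing_shear; auto using smooth_power.
      * intros p _; apply (pd2_fst (fun t => Rpower t s)).
      * intros p hp; rewrite (pd_ext _ _ i1 p (pd1_power s) hp).
        rewrite pd_mult, pd_const, !pd1_power, !power_minus1
          by auto using smooth_const, smooth_power.
        unfold s; ring.
    + apply lin_indep_shear; unfold fst_power; simpl.
      replace (Rpower 1 s) with 1
        by (unfold Rpower; now rewrite ln_1, Rmult_0_r, exp_0).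
      apply not_eq_sym, rpower2_neq1, hs.
Qed.

Lemma pd_inv (i : idx) (m : R) (p : pt) :
  dom p -> pd i (fun q => m * / fst q) p =
  match i with i1 => - m * (/ fst p * / fst p) | i2 => 0 end.
Proof.
  intros hp; pd_expand.
  destruct i; [rewrite pd1_inv by exact hp | rewrite (pd2_fst Rinv)]; ring.
Qed.

Lemma pd_pd_inv (i j : idx) (m : R) (p : pt) :
  dom p -> pd i (pd j (fun q => m * / fst q)) p =
  match i, j with
  | i1, i1 => 2 * m * (/ fst p * / fst p * / fst p)
  | _, _ => 0
  end.
Proof.
  intros hp; rewrite (pd_ext _ _ i p (fun q hq => pd_inv j m q hq) hp).
  destruct j.
  - pd_expand; destruct i; [rewrite pd1_inv by exact hp | rewrite (pd2_fst Rinv)]; ring.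
  - rewrite pd_const; now destruct i.
Qed.

(** In the coordinates [x1] and [x2 + m * x1] the connection has only the coefficients
    with upper index 1 and lower indices 11 and 22, the first one being [1 / x1].  Then
    [x1 ^ 2 + const * y ^ 2] and [y] are affine coordinates, where [y = x2 + m * x1],
    and this field is, up to a factor, the constant field along the first of them. *)
Lemma killing_radial (C : idx -> idx -> idx -> R) (m : R) :
  (forall i j k, C i j k = C j i k) ->
  case3 C m -> C i1 i2 i1 = m * C i2 i2 i1 ->
  C i1 i1 i1 = 1 - C i1 i2 i2 ->
  killing (type_B C) (fun p => (1 * / fst p, - m * / fst p)).
Proof.
  intros hC (hb & hd & hf) hc ha; apply killing_coord; [apply smooth_type_B | |].
  - apply smooth_vf_pair; auto with smooth.
  - intros i j k p hp.
    destruct k; killing_simpl; rewrite !pd_pd_inv, !pd_inv by exact hp;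
      unfold dom in hp; destruct i, j; rewrite ?(hC i2 i1), ?hb, ?hf, ?ha, ?hd, ?hc;
      field; lra.
Qed.

(** The hypotheses are the four equations [ric C i j = 0], after eliminating [f]. *)
Lemma flat_cases (a b c d e f : R) :
  f = - c -> c * d - b * e = c -> e * (a - d - 1) = 2 * c ^ 2 ->
  d * (d - a - 1) = - 2 * b * c ->
  (c = 0 /\ e = 0 /\ f = 0) \/
  (exists m, c = m * e /\ a = 1 - d /\ b = - m * a /\ d = - m * c /\ f = - m * e).
Proof.
  intros hf h1 h2 h3; destruct (Req_dec e 0) as [he|he].
  - left; subst e; assert (c = 0) by nra; lra.
  - right; exists (c / e).
    assert (hc : c = c / e * e) by now field.
    set (m := c / e) in *; clearbody m.
    assert (hb : b = m * (d - 1)).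
    { apply Rmult_eq_reg_r with e; [|exact he].
      replace (m * (d - 1) * e) with (m * e * (d - 1)) by ring; rewrite <- hc; lra. }
    assert (ha : a - d - 1 = 2 * m ^ 2 * e).
    { apply Rmult_eq_reg_l with e; [rewrite h2, hc; ring | exact he]. }
    (* Expanding this relation leaves [a + d = 1]. *)
    assert (h4 : d * (d - a - 1) = - (a - d - 1) * (d - 1))
      by (rewrite h3, ha, hb, hc; ring).
    assert (ha' : a = 1 - d) by lra.
    repeat split; [exact hc | exact ha' | rewrite hb, ha'; ring | rewrite hc; lra |].
    rewrite hf, hc; ring.
Qed.

Lemma flat_not_dim2 (C : idx -> idx -> idx -> R) :
  (forall i j k, C i j k = C j i k) ->
  ~ rho_tilde_nonzero (type_B C) -> ~ has_dim (killing (type_B C)) 2.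
Proof.
  intros hC hr hdim.
  pose proof (ric_zero C hr) as H.
  pose proof (H i1 i1) as r11; pose proof (H i1 i2) as r12;
    pose proof (H i2 i1) as r21; pose proof (H i2 i2) as r22.
  unfold ric, sum_idx in r11, r12, r21, r22; rewrite ?(hC i2 i1) in *.
  assert (f0 : C i2 i2 i2 = - C i1 i2 i1) by lra.
  rewrite f0 in r11, r12, r21, r22.
  destruct (flat_cases (C i1 i1 i1) (C i1 i1 i2) (C i1 i2 i1) (C i1 i2 i2)
    (C i2 i2 i1) (C i2 i2 i2)) as [(hc & he & hf) | (m & hc & ha & hb & hd & hf)];
    try lra.
  - now apply (degenerate_not_dim2 C).
  - apply (dim2_no_three _ (coord_vf i2) euler (fun p => (1 * / fst p, - m * / fst p)) hdim);
      auto using killing_d2, killing_euler.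
    + apply killing_radial; unfold case3; repeat split; assumption.
    + apply lin_indep_third; intros a1 a2 a3 K.
      assert (d1 : dom (1, 0)) by (unfold dom; simpl; lra).
      assert (d2 : dom (2, 0)) by (unfold dom; simpl; lra).
      destruct (K _ d1) as [K1 K2], (K _ d2) as [K3 K4]; simpl in *.
      rewrite Rinv_1 in *.
      assert (a3 = 0) by lra; subst a3; lra.
Qed.

(** * The classification *)

(** Passing the gradient as explicit functions [u], [v] lets the Hessian be computed
    with first derivatives only. *)
Lemma E0_of_gradient (C : idx -> idx -> idx -> R) (g u v : pt -> R) :
  smooth g ->
  (forall p, dom p -> pd i1 g p = u p) -> (forall p, dom p -> pd i2 g p = v p) ->
  (forall i p, dom p ->
     pd i u p = / fst p * (C i i1 i1 * u p + C i i1 i2 * v p) /\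
     pd i v p = / fst p * (C i i2 i1 * u p + C i i2 i2 * v p)) ->
  E0 (type_B C) g.
Proof.
  intros sg hu hv h; split; [exact sg|]; intros i j p hp.
  destruct (h i p hp) as [h1 h2].
  unfold hessian, sum_idx, type_B; rewrite hu, hv by exact hp; destruct j.
  - rewrite (pd_ext _ u i p hu hp), h1; ring.
  - rewrite (pd_ext _ v i p hv hp), h2; ring.
Qed.

Lemma span_type_B (C : idx -> idx -> idx -> R) (g w : pt -> R) (i : idx) :
  rho_tilde_nonzero (type_B C) -> E0 (type_B C) g ->
  smooth w -> (forall p, dom p -> w p * pd i g p = 1) ->
  is_span (E0 (type_B C)) [fun _ : pt => 1; g].
Proof.
  intros hr hg sw hw; apply (span_one_fun _ g w i); auto.
  intros f p hf hp; now apply (E0_gradients_proportional C).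
Qed.

Lemma span_case1 (C : idx -> idx -> idx -> R) :
  (forall i j k, C i j k = C j i k) ->
  rho_tilde_nonzero (type_B C) -> case1 C ->
  is_span (E0 (type_B C)) [fun _ : pt => 1; fun p : pt => ln (fst p)].
Proof.
  intros hC hr (ha & hc & he & _).
  apply (span_type_B C ln_fst (fun p => fst p) i1 hr).
  - apply (E0_of_gradient C ln_fst (fun p => / fst p) (fun _ => 0) smooth_ln pd1_ln).
    + intros p _; exact (pd2_fst ln p).
    + intros i p hp; rewrite pd_const; destruct i;
        [rewrite pd1_inv by exact hp | rewrite (pd2_fst Rinv)];
        rewrite ?(hC i2 i1), ?ha, ?hc, ?he; split; ring.
  - apply smooth_fst.
  - intros p hp; rewrite pd1_ln by exact hp; unfold dom in hp; field; lra.
Qed.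

Lemma span_case3 (C : idx -> idx -> idx -> R) (c1 : R) :
  (forall i j k, C i j k = C j i k) ->
  rho_tilde_nonzero (type_B C) -> case3 C c1 ->
  is_span (E0 (type_B C)) [fun _ : pt => 1; fun p : pt => snd p + c1 * fst p].
Proof.
  intros hC hr (hb & hd & hf).
  assert (hv : forall i p, dom p -> pd i (fun p => snd p + c1 * fst p) p =
    match i with i1 => c1 | i2 => 1 end).
  { intros i p hp; pd_expand; rewrite pd_snd, pd_fst; destruct i; ring. }
  apply (span_type_B C _ (fun _ => 1) i2 hr); [|apply smooth_const|].
  - apply (E0_of_gradient C _ (fun _ => c1) (fun _ => 1));
      [auto with smooth | exact (hv i1) | exact (hv i2) |].
    intros i p hp; rewrite !pd_const; destruct i;
      rewrite ?(hC i2 i1), ?hb, ?hd, ?hf; split; ring.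
  - intros p hp; rewrite hv by exact hp; ring.
Qed.

Lemma span_case2 (C : idx -> idx -> idx -> R) :
  (forall i j k, C i j k = C j i k) ->
  rho_tilde_nonzero (type_B C) -> case2 C ->
  is_span (E0 (type_B C)) [fun _ : pt => 1; fun p : pt => snd p].
Proof.
  intros hC hr (hb & hd & hf) f.
  assert (h3 : case3 C 0) by (unfold case3; lra).
  rewrite (span_case3 C 0 hC hr h3 f : E0 _ f <-> _).
  rewrite !in_span_one_fun; split; intros (c & k & h); exists c, k;
    intros p hp; rewrite (h p hp); ring.
Qed.

Lemma span_case4 (C : idx -> idx -> idx -> R) :
  (forall i j k, C i j k = C j i k) ->
  rho_tilde_nonzero (type_B C) -> case4 C ->
  is_span (E0 (type_B C))
    [fun _ : pt => 1; fun p : pt => Rpower (fst p) (C i1 i1 i1 + 1)].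
Proof.
  intros hC hr (hc & he & ha & _).
  set (s := C i1 i1 i1 + 1); assert (hs : s <> 0) by (unfold s; lra).
  apply (span_type_B C (fst_power s) (fun p => / s * fst_power (1 - s) p) i1 hr).
  - apply (E0_of_gradient C (fst_power s) (fun p => s * fst_power (s - 1) p) (fun _ => 0)
      (smooth_power s) (pd1_power s)).
    + intros p _; exact (pd2_fst (fun t => Rpower t s) p).
    + intros i p hp; rewrite pd_const; pd_expand; destruct i;
        [rewrite pd1_power, (power_minus1 (s - 1)) by exact hp
        |rewrite (pd2_fst (fun t => Rpower t (s - 1)))];
        rewrite ?(hC i2 i1), ?hc, ?he; unfold s; split; ring.
  - auto with smooth.
  - intros p hp; rewrite pd1_power by exact hp.
    transitivity (/ s * s * (fst_power (1 - s) p * fst_power (s - 1) p)); [ring|].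
    unfold fst_power; rewrite <- Rpower_plus.
    replace (1 - s + (s - 1)) with 0 by ring.
    rewrite Rpower_O by exact hp; field; exact hs.
Qed.

(** A non-constant solution lands in one of the listed cases, or in one of the two
    situations that carry a third Killing field. *)
Lemma span_generic (C : idx -> idx -> idx -> R) :
  (forall i j k, C i j k = C j i k) -> has_dim (killing (type_B C)) 2 ->
  ~ (rho_tilde_nonzero (type_B C) /\
      (case1 C \/ case2 C \/ (exists c1, case3 C c1) \/ case4 C)) ->
  is_span (E0 (type_B C)) [fun _ : pt => 1].
Proof.
  intros hC hdim hn; apply span_one; intros f i p hf hp.
  destruct (Req_dec (pd i f p) 0) as [z|z]; [exact z | exfalso].
  destruct (Classical_Prop.classic (rho_tilde_nonzero (type_B C))) as [hr|hr];
    [|now apply (flat_not_dim2 C)].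
  apply hn; split; [exact hr|].
  destruct (E0_nonconstant_cases C f i p hC hr hf hp z) as [h|[hc he]]; [auto|].
  destruct (Req_dec (C i2 i2 i2) 0) as [hf0|hf0];
    [exfalso; now apply (degenerate_not_dim2 C)|].
  destruct (Req_dec (C i1 i1 i1) (-1)) as [ha|ha];
    [left | right; right; right]; unfold case1, case4; auto.
Qed.

Ltac ric_compute hC :=
  rewrite !rho_tilde_type_B by assumption;
  unfold ric, sum_idx; rewrite ?(hC i2 i1).

Theorem theorem5p6 (C : idx -> idx -> idx -> R)
  (C_sym : forall i j k, C i j k = C j i k)
  (dim_K : has_dim (killing (type_B C)) 2) :
  (~ (rho_tilde_nonzero (type_B C) /\
      (case1 C \/ case2 C \/ (exists c1, case3 C c1) \/ case4 C)) ->
   is_span (E0 (type_B C)) [fun _ : pt => 1])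
  /\
  (rho_tilde_nonzero (type_B C) -> case1 C ->
   is_span (E0 (type_B C)) [fun _ : pt => 1; fun p : pt => ln (fst p)] /\
   forall p, dom p ->
     rho_tilde (type_B C) i1 i1 p
       = - (C i1 i2 i2) ^ 2 + C i1 i1 i2 * C i2 i2 i2 /\
     rho_tilde (type_B C) i1 i2 p = C i2 i2 i2 /\
     rho_tilde (type_B C) i2 i1 p = 0 /\
     rho_tilde (type_B C) i2 i2 p = 0)
  /\
  (rho_tilde_nonzero (type_B C) -> case2 C ->
   is_span (E0 (type_B C)) [fun _ : pt => 1; fun p : pt => snd p] /\
   forall p, dom p ->
     rho_tilde (type_B C) i1 i1 p = 0 /\
     rho_tilde (type_B C) i1 i2 p = 0 /\
     rho_tilde (type_B C) i2 i1 p = - C i1 i2 i1 /\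
     rho_tilde (type_B C) i2 i2 p
       = (C i1 i1 i1 - 1) * C i2 i2 i1 - (C i1 i2 i1) ^ 2)
  /\
  (forall c1 : R, rho_tilde_nonzero (type_B C) -> case3 C c1 ->
   is_span (E0 (type_B C))
     [fun _ : pt => 1; fun p : pt => snd p + c1 * fst p] /\
   forall p, dom p ->
     rho_tilde (type_B C) i2 i1 p
       = c1 * C i1 i1 i1 * C i2 i2 i1 - C i1 i2 i1 * (1 + c1 * C i1 i2 i1) /\
     rho_tilde (type_B C) i1 i1 p = c1 * rho_tilde (type_B C) i2 i1 p /\
     rho_tilde (type_B C) i2 i2 p
       = C i2 i2 i1 * (C i1 i1 i1 - 1) - (C i1 i2 i1) ^ 2 /\
     rho_tilde (type_B C) i1 i2 p = c1 * rho_tilde (type_B C) i2 i2 p)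
  /\
  (rho_tilde_nonzero (type_B C) -> case4 C ->
   is_span (E0 (type_B C))
     [fun _ : pt => 1; fun p : pt => Rpower (fst p) (C i1 i1 i1 + 1)] /\
   forall p, dom p ->
     rho_tilde (type_B C) i1 i1 p
       = - (C i1 i2 i2) ^ 2 + C i1 i1 i1 * C i1 i2 i2 + C i1 i2 i2
         + C i1 i1 i2 * C i2 i2 i2 /\
     rho_tilde (type_B C) i1 i2 p = C i2 i2 i2 /\
     rho_tilde (type_B C) i2 i1 p = 0 /\
     rho_tilde (type_B C) i2 i2 p = 0).
Proof.
  split; [|split; [|split; [|split]]].
  - now apply span_generic.
  - intros hr h; split; [now apply span_case1|]; intros p hp.
    destruct h as (ha & hc & he & _); ric_compute C_sym.
    rewrite ha, hc, he; repeat split; ring.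
  - intros hr h; split; [now apply span_case2|]; intros p hp.
    destruct h as (hb & hd & hf); ric_compute C_sym.
    rewrite hb, hd, hf; repeat split; ring.
  - intros c1 hr h; split; [now apply span_case3|]; intros p hp.
    destruct h as (hb & hd & hf); ric_compute C_sym.
    rewrite hb, hd, hf; repeat split; ring.
  - intros hr h; split; [now apply span_case4|]; intros p hp.
    destruct h as (hc & he & _); ric_compute C_sym.
    rewrite hc, he; repeat split; ring.
Qed.
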